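(* Let $d,n\ge 1$ be integers, let $\mathcal{P}_n\subset\mathbb{R}$ be a set of $n$ distinct interpolation points, let $\mu\in\mathbb{R}$ and $x\in\mathbb{R}^d$, and let $I\subset\mathbb{R}$ be a compact interval containing $\mathcal{P}_n$ and $\mu$. For each $\eta\in\mathcal{P}_n$ let $\Phi(\cdot,\eta):\mathbb{R}^d\to\mathbb{R}^d$ be a given map. Consider the interpolation problem: find $X\in\mathbb{P}^n$ (restricted to $I$) such that $$X'(\eta)=\Phi(X(\eta),\eta)\quad\text{for all }\eta\in\mathcal{P}_n,\qquad X(\mu)=x. \qquad ( * )$$ 1. Assume that all $\Phi(\cdot,\eta)$, $\eta\in\mathcal{P}_n$, are bounded and continuous. Then the interpolation problem $( * )$ has a solution in $\mathbb{P}^n$ restricted to $I$. 2. Assume that all $\Phi(\cdot,\eta)$, $\eta\in\mathcal{P}_n$, are Lipschitz continuous with Lipschitz constant $L$ and that $\Lambda_{n-1}L|I|<1$, where $\Lambda_{n-1}:=\max_{\xi\in I}\sum_{\eta\in\mathcal{P}_n}|\ell_\eta(\xi)|$. Then the interpolation problem $( * )$ has a unique solution in $\mathbb{P}^n$ restricted to $I$.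
   Context: $\mathbb{P}^n$ denotes the space of $\mathbb{R}^d$-valued polynomials of degree at most $n$ in one real variable. For $\eta\in\mathcal{P}_n$, $\ell_\eta$ is the (scalar) Lagrange basis polynomial of degree $n-1$ with $\ell_\eta(\eta)=1$ and $\ell_\eta(\gamma)=0$ for $\gamma\in\mathcal{P}_n\setminus\{\eta\}$; $\Lambda_{n-1}$ is the Lebesgue constant of the points $\mathcal{P}_n$ on $I$. $|I|$ is the length of $I$. Lipschitz continuity is with respect to the Euclidean norm $|\cdot|$ on $\mathbb{R}^d$. *)

(* Defs.v *)
From HB Require Import structures.
From mathcomp Require Import all_boot all_order all_algebra finmap.
From mathcomp Require Import all_classical all_reals all_analysis.

Set Implicit Arguments.
Unset Strict Implicit.
Unset Printing Implicit Defensive.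

Import Order.TTheory GRing.Theory Num.Theory.
Import numFieldNormedType.Exports.

Local Open Scope fset_scope.
Local Open Scope classical_set_scope.
Local Open Scope ring_scope.

(* The library norm `|v| on 'rV[R]_d is the sup norm, hence this one. *)
Definition enorm (R : realType) (d : nat) (v : 'rV[R]_d) : R :=
  Num.sqrt (\sum_(i < d) v 0 i ^+ 2).

Definition elipschitz (R : realType) (d : nat) (L : R)
    (f : 'rV[R]_d -> 'rV[R]_d) : Prop :=
  forall y z, enorm (f y - f z) <= L * enorm (y - z).

Definition ebounded (R : realType) (d : nat) (f : 'rV[R]_d -> 'rV[R]_d)
  : Prop :=
  exists M : R, forall y, enorm (f y) <= M.

(* R^d-valued polynomials are row vectors of scalar polynomials. *)
Definition vhorner (R : realType) (d : nat) (X : 'rV[{poly R}]_d) (t : R)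
  : 'rV[R]_d :=
  map_mx (horner^~ t) X.

Definition vderiv (R : realType) (d : nat) (X : 'rV[{poly R}]_d)
  : 'rV[{poly R}]_d :=
  map_mx (@deriv R) X.

Definition vdeg_le (R : realType) (d n : nat) (X : 'rV[{poly R}]_d) : Prop :=
  forall i, (size (X 0%R i) <= n.+1)%N.

(* On an interval with nonempty interior a polynomial is determined by its
   restriction. *)
Lemma vhorner_itv_inj (R : realType) (d : nat) (a b : R)
    (X Y : 'rV[{poly R}]_d) : a < b ->
  (forall t, t \in `[a, b] -> vhorner X t = vhorner Y t) -> X = Y.
Proof.
move=> ltab XY; apply/rowP => i; apply/eqP; rewrite -subr_eq0.
apply/negPn/negP => nz.
set p := X 0 i - Y 0 i in nz.
pose pt (k : nat) := a + (b - a) / k.+1%:R.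
have pt_inj : injective pt.
  move=> k l /addrI /mulfI H; apply/eqP; rewrite -eqSS -(eqr_nat R).
  by apply/eqP/invr_inj/H; rewrite subr_eq0 gt_eqF.
have rt k : root p (pt k).
  have ptI : pt k \in `[a, b].
    rewrite in_itv /= /pt lerDl divr_ge0 ?subr_ge0 ?(ltW ltab) //=.
    rewrite -lerBrDl ler_pdivrMr // ler_peMr ?subr_ge0 ?(ltW ltab) //.
    by rewrite ler1n.
  move: (XY _ ptI) => /rowP /(_ i); rewrite !mxE => e.
  by rewrite /root hornerD hornerN e subrr.
have := @max_poly_roots _ p (map pt (iota 0 (size p))) nz.
rewrite size_map size_iota ltnn => H; suff : false by []; apply: H.
  by apply/allP => _ /mapP[k _ ->].
by rewrite map_inj_uniq ?iota_uniq.
Qed.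

Definition lagrange_basis (R : realType) (P : {fset R}) (eta : R) : {poly R} :=
  \prod_(gamma <- P | gamma != eta)
    ((eta - gamma)^-1 *: ('X - gamma%:P)).

Lemma lagrange_basis_sample (R : realType) (P : {fset R}) (eta gamma : R) :
  gamma \in P -> (lagrange_basis P eta).[gamma] = (gamma == eta)%:R.
Proof.
move=> gP; rewrite /lagrange_basis horner_prod.
case: eqVneq => [->|ne].
  apply: big1_seq => k /andP[ke _].
  by rewrite hornerZ hornerXsubC mulVf // subr_eq0 eq_sym.
by rewrite (big_rem gamma) //= ne hornerZ hornerXsubC subrr mulr0 mul0r.
Qed.

Lemma size_lagrange_basis (R : realType) (P : {fset R}) (eta : R) :
  eta \in P -> size (lagrange_basis P eta) = #|` P|.
Proof.
move=> eP; rewrite /lagrange_basis scaler_prod size_scale; last first.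
  rewrite prodf_seq_neq0; apply/allP => k _; apply/implyP => ke.
  by rewrite invr_eq0 subr_eq0 eq_sym.
rewrite -big_filter size_prod_XsubC size_filter.
have := count_predC (pred1 eta) P.
rewrite -/(count_mem eta P) count_uniq_mem ?fset_uniq // eP => <-.
by [].
Qed.

Definition lebesgue_constant (R : realType) (P : {fset R}) (a b : R) : R :=
  sup [set \sum_(eta <- P) `|(lagrange_basis P eta).[xi]| | xi in `[a, b]].

(* The supremum is a maximum. *)
Lemma lebesgue_constant_max (R : realType) (P : {fset R}) (a b : R) :
  a <= b ->
  (exists2 xi, xi \in `[a, b] &
    lebesgue_constant P a b = \sum_(eta <- P) `|(lagrange_basis P eta).[xi]|) /\
  (forall xi, xi \in `[a, b] ->
    \sum_(eta <- P) `|(lagrange_basis P eta).[xi]| <= lebesgue_constant P a b).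
Proof.
move=> leab; pose F xi := \sum_(eta <- P) `|(lagrange_basis P eta).[xi]|.
have cF : continuous F.
  move=> t; rewrite /F; apply: cvg_big => [|eta _]; first exact: add_continuous.
  by apply: cvg_norm; exact: continuous_horner.
have [|c cI cmax] := @EVT_max R F a b leab.
  exact: continuous_subspaceT.
have e : lebesgue_constant P a b = F c.
  apply/eqP; rewrite eq_le; apply/andP; split.
    apply: ge_sup; first by exists (F c); exists c.
    by move=> _ [t tI <-]; exact: cmax.
  apply: ub_le_sup; last by exists c.
  by exists (F c) => _ [t tI <-]; exact: cmax.
by split; [exists c | move=> t tI; rewrite e; exact: cmax].
Qed.

Definition interp_solution (R : realType) (d n : nat) (P : {fset R})
    (Phi : 'rV[R]_d -> R -> 'rV[R]_d) (mu : R) (x : 'rV[R]_d)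
    (X : 'rV[{poly R}]_d) : Prop :=
  [/\ vdeg_le n X,
      forall eta, eta \in P ->
        vhorner (vderiv X) eta = Phi (vhorner X eta) eta
    & vhorner X mu = x].

(* Main.v *)
Require Import Defs.
From mathcomp Require Import all_boot all_order all_algebra finmap.
From mathcomp Require Import fingroup perm zify ring lra.
From mathcomp Require Import all_classical all_reals all_analysis.

Set Implicit Arguments.
Unset Strict Implicit.
Unset Printing Implicit Defensive.

Import Order.TTheory GRing.Theory Num.Theory.
Import numFieldNormedType.Exports.

Local Open Scope fset_scope.
Local Open Scope classical_set_scope.
Local Open Scope ring_scope.

(* A polynomial of degree at most n is determined by its value at mu and by the
   values of its derivative at the n nodes, so the interpolation problem is a
   fixed-point equation for the nodal derivatives in R^(n d). Its right-hand
   side is bounded and continuous when the Phi(., eta) are, and Brouwer's theorem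
   gives a solution.

   Brouwer's theorem is proved with Kuhn simplices on a discrete torus. Label a
   grid point by the signs of the components of y - g(y). The signed sum, over
   all simplices, of the determinants of the vertex labels bordered by ones
   vanishes, since its expansion along the ones cancels on shared facets.
   Comparison with a labelling for which the contribution of the inner cubes is
   a factorial shows that on some inner cube every component changes sign;
   refine the grid and use compactness.

   In the Lipschitz case, the mean value theorem and Lagrange interpolation of X'
   give |X(t) - X(mu)| <= |I| Lambda max |X'(eta)|. Applied to the difference of
   two solutions this is a contraction, whence uniqueness; applied to a solution
   for the maps truncated to a large ball, it shows that the truncation is not
   felt, whence existence. *)

(** * Kuhn simplices on a discrete torus *)

(* Vertices of Kuhn's simplex at [q] in direction [s]: unit steps are taken along
   the axes [s 0], [s 1], ..., so axis [i] has been stepped along by time [j]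
   iff [s^-1 i < j]. Coordinates live modulo [p.+1], on a torus, so that every
   facet belongs to exactly two simplices. *)
Definition kuhn_vertex (p n : nat) (q : {ffun 'I_n -> 'I_p.+1}) (s : 'S_n)
    (j : nat) : {ffun 'I_n -> 'I_p.+1} :=
  [ffun i => inord ((q i + ((s^-1)%g i < j)%N) %% p.+1)%N].

(** The cycle of all axes; written as a lift of the identity, its sign is immediate. *)
Definition rot_perm (n : nat) : 'S_n.+1 := lift_perm ord_max ord0 1%g.

Lemma rot_permE n (i : 'I_n.+1) : rot_perm n i = (i.+1 %% n.+1)%N :> nat.
Proof.
rewrite /rot_perm; case: (unliftP ord_max i) => [k ->|->].
  rewrite lift_perm_lift perm1 lift_max /= /bump leq0n add1n modn_small // ltnS; exact: ltn_ord.
by rewrite lift_perm_id /= modnn.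
Qed.

Lemma odd_rot_perm n : (rot_perm n : bool) = odd n.
Proof. by rewrite /rot_perm odd_lift_perm odd_perm1 /= !addbF. Qed.

Definition kuhn_face (p n : nat) (q : {ffun 'I_n -> 'I_p.+1}) (s : 'S_n)
    (i : 'I_n.+1) (j : 'I_n) := kuhn_vertex q s (lift i j).

(** The shifted simplex steps along [s 1], ..., [s n], [s 0], hence follows the same path until its
    last step. *)
Lemma kuhn_vertex_shift p n (q : {ffun 'I_n.+1 -> 'I_p.+1}) (s : 'S_n.+1) j :
  (j <= n)%N ->
  kuhn_vertex (kuhn_vertex q s 1) (rot_perm n * s)%g j = kuhn_vertex q s j.+1.
Proof.
move=> jn; apply/ffunP => i; rewrite !ffunE.
rewrite inordK ?ltn_pmod // modnDml; congr (inord (_ %% _)).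
rewrite -addnA; congr (_ + _)%N.
rewrite invMg permM; set k := (s^-1)%g i.
set l := ((rot_perm n)^-1%g k).
have := rot_permE l; rewrite /l permKV -/l.
have := ltn_ord l; have := ltn_ord k.
case: (ltnP l n) => [ln _ _|ln kn ll].
  by rewrite modn_small // => ->; rewrite !ltnS ltn0.
have -> : (l : nat) = n by lia.
rewrite modnn => -> /=; lia.
Qed.

(** Swapping two consecutive steps moves only the vertex between them, at time [k]. *)
Lemma kuhn_vertex_tperm p n (q : {ffun 'I_n -> 'I_p.+1}) (s : 'S_n)
    (i k : 'I_n) j :
  i.+1 = k -> j != k :> nat ->
  kuhn_vertex q (tperm i k * s)%g j = kuhn_vertex q s j.
Proof.
move=> ik jk; apply/ffunP => l; rewrite !ffunE invMg permM tpermV.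
congr (inord ((_ + nat_of_bool _) %% _)).
set m := (s^-1)%g l; case: tpermP => [->|->|//]; lia.
Qed.

(* An inner facet [0 < i < n.+1] is shared with the simplex whose steps [i.-1] and
   [i] are swapped; facet [0] is the last facet of the simplex shifted by one
   step, whose direction is rotated. The signs are opposite in both cases. *)
Lemma kuhn_stokes p n
    (c : ('I_n.+1 -> {ffun 'I_n.+1 -> 'I_p.+1}) -> int) :
  (forall f g, f =1 g -> c f = c g) ->
  \sum_(q : {ffun 'I_n.+1 -> 'I_p.+1}) \sum_(s : 'S_n.+1)
     (-1) ^+ s * \sum_(i < n.+2) (-1) ^+ i * c (kuhn_face q s i) = 0.
Proof.
move=> c_ext.
pose S i := \sum_(q : {ffun 'I_n.+1 -> 'I_p.+1}) \sum_(s : 'S_n.+1)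
   (-1) ^+ s * c (kuhn_face q s i).
transitivity (\sum_(i < n.+2) (-1) ^+ i * S i).
  transitivity (\sum_(i < n.+2) \sum_(q : {ffun 'I_n.+1 -> 'I_p.+1})
    \sum_(s : 'S_n.+1) (-1) ^+ s * ((-1) ^+ i * c (kuhn_face q s i))).
    rewrite [RHS]exchange_big; apply: eq_bigr => q _.
    rewrite [RHS]exchange_big; apply: eq_bigr => s _.
    by rewrite mulr_sumr.
  apply: eq_bigr => i _; rewrite mulr_sumr; apply: eq_bigr => q _.
  by rewrite mulr_sumr; apply: eq_bigr => s _; rewrite mulrCA.
have S_inner (i : 'I_n.+2) : i != ord0 -> i != ord_max -> S i = 0.
  move=> i0 im.
  have hk : (i < n.+1)%N.
    by have := ltn_ord i; move: im; rewrite -val_eqE /=; lia.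
  have hj : (i.-1 < n.+1)%N by lia.
  have ip : (0 < i)%N by rewrite lt0n.
  pose a := Ordinal hj; pose b := Ordinal hk.
  have ab : a != b by rewrite -val_eqE /=; lia.
  suff : S i = - S i by move=> e; lia.
  rewrite {1}/S -sumrN; apply: eq_bigr => q _.
  rewrite [LHS](reindex_inj (mulgI (tperm a b))) -sumrN /=; apply: eq_bigr => s _.
  rewrite odd_mul_tperm ab signr_addb mulN1r mulNr; congr (- _); congr (_ * _).
  apply: c_ext => j; apply: kuhn_vertex_tperm; first by rewrite /= prednK.
  by rewrite eq_sym; exact: neq_lift.
rewrite big_ord_recl big_ord_recr /= big1 ?addr0 ?add0r; last first.
  by move=> i _; rewrite S_inner ?mulr0 // -val_eqE /= /bump /=; have := ltn_ord i; lia.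
(* Only the two outer facets remain. The rotation has sign [(-1) ^+ n], opposite to that of facet
   [n.+1]. *)
suff -> : S ord0 = (-1) ^+ n * S ord_max.
  have -> : lift ord0 ord_max = ord_max :> 'I_n.+2 by apply: val_inj.
  by rewrite /= /bump /= add1n exprS expr0; ring.
rewrite /S mulr_sumr.
transitivity (\sum_(s : 'S_n.+1) \sum_(q : {ffun 'I_n.+1 -> 'I_p.+1})
  (-1) ^+ n * ((-1) ^+ (rot_perm n * s)%g *
   c (kuhn_face (kuhn_vertex q s 1) (rot_perm n * s)%g ord_max))).
  rewrite exchange_big; apply: eq_bigr => s _; apply: eq_bigr => q _.
  rewrite odd_permM odd_rot_perm signr_addb signr_odd !mulrA -exprD addnn.
  rewrite -mul2n exprM sqrrN !expr1n mul1r; congr (_ * _); apply: c_ext => j.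
  by rewrite /kuhn_face lift0 lift_max kuhn_vertex_shift // -ltnS.
under [RHS]eq_bigr do rewrite mulr_sumr.
rewrite [RHS]exchange_big [RHS](reindex_inj (mulgI (rot_perm n))).
apply: eq_bigr => s _ /=.
(* Modulo [p.+1] a unit step permutes the grid, so base points can be reindexed. *)
have inj : injective (fun q : {ffun 'I_n.+1 -> 'I_p.+1} => kuhn_vertex q s 1).
  move=> q r /ffunP e; apply/ffunP => i; move: (e i); rewrite !ffunE.
  move/(congr1 val); rewrite /= !inordK ?ltn_pmod // => /eqP.
  rewrite eqn_modDr !modn_small // => /eqP; exact: val_inj.
by rewrite [RHS](reindex_inj inj).
Qed.

(* Row [0] is constantly [1], row [k.+1] lists the labels [l k] of the vertices. *)
Definition simplex_mx p n (l : 'I_n -> {ffun 'I_n -> 'I_p.+1} -> int)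
    (q : {ffun 'I_n -> 'I_p.+1}) (s : 'S_n) : 'M[int]_n.+1 :=
  \matrix_(k, j) oapp (fun i => l i (kuhn_vertex q s j)) 1 (unlift ord0 k).

Lemma sum_det_simplex_mx p n
    (l : 'I_n.+1 -> {ffun 'I_n.+1 -> 'I_p.+1} -> int) :
  \sum_(q : {ffun 'I_n.+1 -> 'I_p.+1}) \sum_(s : 'S_n.+1)
     (-1) ^+ s * \det (simplex_mx l q s) = 0.
Proof.
rewrite -[RHS](@kuhn_stokes p n (fun v => \det (\matrix_(k, j) l k (v j)))).
  apply: eq_bigr => q _; apply: eq_bigr => s _; congr (_ * _).
  rewrite (expand_det_row _ ord0); apply: eq_bigr => i _.
  rewrite mxE unlift_none mul1r /cofactor add0n; congr (_ * \det _).
  by apply/matrixP => k j; rewrite !mxE liftK.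
by move=> f g fg; congr (\det _); apply/matrixP => k j; rewrite !mxE fg.
Qed.

(** A label constant on the simplex yields a zero row or a second row of ones, so the determinant
    vanishes. *)
Lemma det_simplex_mx_neq0 p n
    (l : 'I_n -> {ffun 'I_n -> 'I_p.+1} -> bool) q (s : 'S_n) :
  \det (simplex_mx (fun k x => (l k x)%:R) q s) != 0 ->
  forall k b, exists j : 'I_n.+1, l k (kuhn_vertex q s j) = b.
Proof.
move=> det0 k b.
case: (pickP (fun j : 'I_n.+1 => l k (kuhn_vertex q s j) == b)) => [j /eqP|H].
  by exists j.
have {}H j : l k (kuhn_vertex q s (j : 'I_n.+1)) = ~~ b.
  by move: (H j) => /negbT; case: (l k _); case: (b).
case/eqP: det0; case: b H => H.
  rewrite (expand_det_row _ (lift ord0 k)) big1 // => j _.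
  by rewrite mxE liftK /= H mul0r.
apply: (@determinant_alternate _ _ _ ord0 (lift ord0 k)) => // j.
by rewrite !mxE unlift_none liftK /= H.
Qed.

(* The cubes that do not wrap around the torus. *)
Definition inner_cube p n (q : {ffun 'I_n -> 'I_p.+1}) :=
  [forall i, q i != ord_max].

Lemma kuhn_vertex_inner p n (q : {ffun 'I_n -> 'I_p.+1}) (s : 'S_n) j i :
  inner_cube q -> kuhn_vertex q s j i = (q i + ((s^-1)%g i < j))%N :> nat.
Proof.
move=> /forallP /(_ i); rewrite -val_eqE /= => qi; rewrite ffunE.
have ? : (q i + ((s^-1)%g i < j)%N < p.+1)%N.
  by have := ltn_ord (q i); lia.
by rewrite modn_small // inordK.
Qed.

(** Label [k] is 1 at vertex [j] iff axis [k] has been stepped along by time [j]. Sorting the rows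
    by [s] leaves a unitriangular matrix, and the two signs cancel. *)
Lemma det_threshold_mx p n (q : {ffun 'I_n -> 'I_p.+1}) (s : 'S_n) (t : nat) :
  inner_cube q -> (forall i, q i = t :> nat) ->
  (-1) ^+ s * \det (simplex_mx (fun k x => (t < x k)%N%:R) q s) = 1.
Proof.
move=> qI qt.
pose A : 'M[int]_n.+1 := \matrix_(k, j) (k <= j)%N%:R.
have -> : simplex_mx (fun k x => (t < x k)%N%:R) q s =
    row_perm (lift_perm ord0 ord0 s^-1%g) A.
  apply/matrixP => k j; rewrite !mxE.
  case: (unliftP ord0 k) => [i ->|->].
    rewrite lift_perm_lift /= kuhn_vertex_inner // qt /= /bump add1n.
    by case: ((s^-1)%g i < j)%N; rewrite ?addn1 ?addn0 ?ltnn ?ltnSn.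
  by rewrite lift_perm_id.
rewrite row_permE det_mulmx det_perm odd_lift_perm addbb odd_permV addFb.
rewrite mulrA -signr_addb addbb mul1r -det_tr det_trig.
  by rewrite big1 // => i _; rewrite !mxE leqnn.
by apply/is_trig_mxP => i j ij; rewrite !mxE leqNgt ij.
Qed.

(* Overwriting the labels on the boundary of the box by the threshold labels
   [t < x k] makes the two labellings agree on all cubes that wrap around, hence
   have the same determinant sum, [(n.+1)`!], over the inner cubes. *)
Lemma kuhn_threshold_cube n t
    (L : 'I_n.+1 -> {ffun 'I_n.+1 -> 'I_t.*2.+2} -> bool) : (0 < t)%N ->
  (forall k (x : {ffun 'I_n.+1 -> 'I_t.*2.+2}), (x k <= 1)%N -> L k x = false) ->
  (forall k (x : {ffun 'I_n.+1 -> 'I_t.*2.+2}), (t.*2 <= x k)%N -> L k x) ->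
  exists q : {ffun 'I_n.+1 -> 'I_t.*2.+2}, forall k b,
    exists2 v : {ffun 'I_n.+1 -> 'I_t.*2.+2},
      forall i, (q i <= v i <= (q i).+1)%N & L k v = b.
Proof.
move=> t0 Llo Lhi; set p := t.*2.+1.
pose bd (x : {ffun 'I_n.+1 -> 'I_p.+1}) :=
  [exists i, (x i == ord0) || (x i == ord_max)].
pose th k (x : {ffun 'I_n.+1 -> 'I_p.+1}) := (t < x k)%N.
pose l k x := if bd x then th k x else L k x.
pose D (l : 'I_n.+1 -> {ffun 'I_n.+1 -> 'I_p.+1} -> bool) q :=
  \sum_(s : 'S_n.+1) (-1) ^+ s * \det (simplex_mx (fun k x => (l k x)%:R) q s).
(* On a wrapping cube some coordinate is [ord_max] or, after a step, 0, so every vertex is on the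
   boundary. *)
have outer q : ~~ inner_cube q -> D l q = D th q.
  rewrite negb_forall => /existsP[i]; rewrite negbK => /eqP qi.
  apply: eq_bigr => s _; congr (_ * \det _); apply/matrixP => k j; rewrite !mxE.
  case: (unlift ord0 k) => //= {}k; rewrite /l ifT //.
  apply/existsP; exists i; rewrite -!val_eqE /= ffunE qi /=.
  case: (_ < _)%N; rewrite ?addn0 ?addn1 ?modnn inordK //.
    by rewrite modn_small // eqxx orbT.
  by rewrite modn_small.
have sumD l' : \sum_q D l' q = 0 by exact: sum_det_simplex_mx.
pose qt : {ffun 'I_n.+1 -> 'I_p.+1} := [ffun=> inord t].
have qtE i : qt i = t :> nat by rewrite ffunE inordK // /p; lia.
have qtI : inner_cube qt.
  by apply/forallP => i; rewrite -val_eqE /= qtE /p; lia.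
(* At [qt] every direction contributes 1. Elsewhere a nonzero determinant would make each axis cross
   the threshold [t], forcing [q = qt]. *)
have Dth : \sum_(q | inner_cube q) D th q = (n.+1)`!%:R.
  rewrite (bigD1 qt) //= big1 ?addr0 => [|q /andP[qI nqt]].
    rewrite /D (eq_bigr (fun=> 1)) ?sumr_const ?card_Sn // => s _.
    exact: det_threshold_mx.
  rewrite /D big1 // => s _; apply/eqP; rewrite mulf_eq0 signr_eq0 /=.
  apply: contraNT nqt => /det_simplex_mx_neq0 H; apply/eqP/ffunP => i.
  apply/val_inj; rewrite /= qtE.
  have [j] := H i true; have [j'] := H i false.
  rewrite /th !kuhn_vertex_inner //; lia.
have : \sum_(q | inner_cube q) D l q != 0.
  have := sumD l; have := sumD th.
  rewrite (bigID (@inner_cube p n.+1)) /= Dth => e1.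
  rewrite (bigID (@inner_cube p n.+1)) /= (eq_bigr _ outer) => e2.
  have -> : \sum_(q | inner_cube q) D l q = (n.+1)`!%:R.
    by apply: (addIr (\sum_(q | ~~ inner_cube q) D th q)); rewrite e1 e2.
  by rewrite pnatr_eq0 -lt0n fact_gt0.
move=> nz; have [q qI Dq] : exists2 q, inner_cube q & D l q != 0.
  case: (pickP (fun q => inner_cube q && (D l q != 0))) => [q /andP[]|H].
    by exists q.
  case/eqP: nz; apply: big1 => q qI.
  by move: (H q); rewrite qI /= => /negbFE/eqP.
have [s ds] : exists s, \det (simplex_mx (fun k x => (l k x)%:R) q s) != 0.
  case: (pickP (fun s => \det (simplex_mx (fun k x => (l k x)%:R) q s) != 0)).
    by move=> s; exists s.
  move=> H; case/eqP: Dq; apply: big1 => s _.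
  by move/negbFE/eqP: (H s) => ->; rewrite mulr0.
have {}ds := det_simplex_mx_neq0 ds.
(* With a boundary vertex, the simplex would lie, along some axis [i], in the two outermost layers
   at one end, where label [i] is constant, against [ds]. *)
have nbd j : ~~ bd (kuhn_vertex q s j).
  apply/negP => /existsP[i]; rewrite -!val_eqE /= kuhn_vertex_inner // => bi.
  have qi : (q i < p)%N.
    by have := forallP qI i; rewrite -val_eqE /=; have := ltn_ord (q i); lia.
  have lE b j' : l i (kuhn_vertex q s j') = b ->
      if (q i == 0 :> nat)%N then b = false else b = true.
    have vE := kuhn_vertex_inner s j' i qI.
    have qi2 : (q i : nat) <> 0%N -> (t.*2 <= q i)%N.
      by case/orP: bi => /eqP; rewrite /p in qi *; lia.
    case: eqP => [q0 <-|/qi2 q0 <-]; rewrite /l /th; case: ifP => _; rewrite ?vE.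
    - lia.
    - by apply: Llo; rewrite vE; lia.
    - apply: leq_trans (leq_addr _ _); apply: leq_trans q0; lia.
    - by apply: Lhi; rewrite vE; lia.
  have [j1 /lE] := ds i true; have [j2 /lE] := ds i false.
  by case: ifP.
exists q => k b; have [j lj] := ds k b.
exists (kuhn_vertex q s j).
  by move=> i; rewrite kuhn_vertex_inner //; lia.
by move: lj; rewrite /l (negbTE (nbd j)).
Qed.

(** * Fixed points of bounded continuous maps *)

Lemma cluster_seq (T : topologicalType) (u : nat -> T) (x : T) (B : set T) N :
  cluster (u @ \oo) x -> nbhs x B -> exists2 t, (N <= t)%N & B (u t).
Proof.
move=> ux xB; have [|_ [[t Nt <-] But]] := ux (u @` [set t | (N <= t)%N]) B _ xB.
  by exists N => // t /= Nt; exists t.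
by exists t.
Qed.

(** If [h x] were nonzero, [h] would keep a strict sign near [x]. *)
Lemma sign_change_eq0 (R : realType) (T : topologicalType) (u : nat -> T)
    (x : T) (h : T -> R) :
  {for x, continuous h} ->
  (forall B, nbhs x B -> exists v w, [/\ B v, B w, h v <= 0 & 0 <= h w]) ->
  h x = 0.
Proof.
move=> hc H; apply/eqP; rewrite eq_le !leNgt; apply/andP; split; apply/negP => hx.
  have [|v [w [/= Bv _ hv _]]] := H (h @^-1` [set y | 0 < y]).
    exact/hc/lt_nbhsr.
  by rewrite ltNge hv in Bv.
have [|v [w [/= _ Bw _ hw]]] := H (h @^-1` [set y | y < 0]).
  exact/hc/lt_nbhsl.
by rewrite ltNge hw in Bw.
Qed.

Lemma bounded_fixpoint (R : realType) (n : nat) (g : 'I_n -> 'rV[R]_n -> R)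
    (M : R) :
  (forall k, continuous (g k)) -> (forall k y, `|g k y| <= M) ->
  exists y : 'rV[R]_n, forall k, g k y = y 0 k.
Proof.
case: n g => [|n] g gc gM; first by exists 0 => -[].
have M0 : 0 <= M by apply: le_trans (gM ord0 0); exact: normr_ge0.
(* The margin 1 exceeds the mesh for large [t], so the two outermost layers at either end lie at or
   beyond [- M] and [M], where the labels are forced. *)
pose K := M + 1.
have K0 : 0 < K by rewrite /K; lra.
(* [pos t] maps the grid [0, ..., 2t+1] affinely onto [- K, K]. *)
pose pos t (i : nat) : R := K * (2 * i%:R - (2 * t + 1)%:R) / (2 * t + 1)%:R.
pose pt t (x : {ffun 'I_n.+1 -> 'I_t.*2.+2}) : 'rV[R]_n.+1 := \row_k pos t (x k).
have [t0 t0K] : exists t0 : nat, K < t0%:R.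
  by exists (Num.truncn K).+1; rewrite truncnS_gt.
have pos_le t (i j : nat) : (i <= j)%N -> pos t i <= pos t j.
  move=> ij; rewrite /pos ler_pM2r ?invr_gt0 ?ltr0n ?addn1 // ler_pM2l //.
  by rewrite lerD2r ler_pM2l // ler_nat.
have pos1 t : (t0 <= t)%N -> pos t 1 <= - M.
  move=> tt; have {tt} : K < t%:R by apply: lt_le_trans t0K _; rewrite ler_nat.
  rewrite /pos natrD natrM /K => Kt; rewrite ler_pdivrMr; nra.
have pos2 t : (t0 <= t)%N -> M < pos t t.*2.
  move=> tt; have {tt} : K < t%:R by apply: lt_le_trans t0K _; rewrite ler_nat.
  rewrite /pos -mul2n natrD !natrM /K => Kt; rewrite ltr_pdivlMr; nra.
pose good t (q : {ffun 'I_n.+1 -> 'I_t.*2.+2}) := forall k b,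
  exists2 v : {ffun 'I_n.+1 -> 'I_t.*2.+2},
    forall i, (q i <= v i <= (q i).+1)%N & (g k (pt t v) < pt t v 0 k) = b.
have good_ex t : (t0 <= t)%N -> exists q, good t q.
  move=> tt.
  have t_gt0 : (0 < t)%N.
    by rewrite -(ltr0n R); apply: lt_trans K0 (lt_le_trans t0K _); rewrite ler_nat.
  have := @kuhn_threshold_cube n t (fun k x => g k (pt t x) < pt t x 0 k) t_gt0.
  apply=> [k x xk|k x xk].
    apply/negbTE; rewrite -leNgt mxE; apply: le_trans (pos_le t _ _ xk) _.
    by apply: le_trans (pos1 _ tt) _; have := gM k (pt t x); rewrite ler_norml => /andP[].
  rewrite mxE; apply: lt_le_trans (pos_le t _ _ xk).
  by apply: le_lt_trans (pos2 _ tt); have := gM k (pt t x); rewrite ler_norml => /andP[].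
pose ok t (y : 'rV[R]_n.+1) := exists2 q : {ffun 'I_n.+1 -> 'I_t.*2.+2},
  good t q & y = pt t q.
have /choice[u uP] : forall t, exists y, (t0 <= t)%N -> ok t y.
  move=> t; case: (leqP t0 t) => [tt|]; last by exists 0.
  by have [q gq] := good_ex t tt; exists (pt t q) => _; exists q.
have pos_itv t (i : nat) : (i < t.*2.+2)%N -> pos t i \in `[- K, K].
  move=> it; rewrite in_itv /= /pos ler_pdivlMr ?ler_pdivrMr ?ltr0n ?addn1 //.
  have : (i%:R : R) <= (2 * t + 1)%:R by rewrite ler_nat -mul2n in it *; lia.
  by have := ler0n R i; rewrite -addn1; set r := (2 * t + 1)%:R; nra.
have [y [_ uy]] : exists y, ([set v : 'rV[R]_n.+1 | forall i, `[- K, K]%classic (v ord0 i)]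
     `&` cluster (u @ \oo)) y.
  apply: (@rV_compact R n.+1 (fun=> `[- K, K]%classic)) => [i|].
    exact: segment_compact.
  exists t0 => // t /= tt i; have [q _ ->] := uP t tt.
  by rewrite mxE; apply: pos_itv; exact: ltn_ord.
exists y => k; apply/eqP; rewrite eq_sym -subr_eq0; apply/eqP.
apply: (@sign_change_eq0 R _ u y (fun y => y 0 k - g k y)).
  apply: (@continuousB _ _ _ (fun y : 'rV[R]_n.+1 => y 0 k) (g k)).
    exact: coord_continuous.
  exact: gc.
move=> B /nbhs_ballP[e /= e0 eB].
(* From [t1] on the mesh [2 * K / (2 * t + 1)] is below [e / 2], so a cube with base corner within
   [e / 2] of [y] stays in [B]. *)
have [t1 t1e] : exists t1 : nat, 2 * K / (e / 2) < t1%:R.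
  by exists (Num.truncn (2 * K / (e / 2))).+1; rewrite truncnS_gt.
have [t] := cluster_seq (maxn t0 t1) uy (nbhsx_ballx y (e / 2) (divr_gt0 e0 (ltr0n _ 2))).
rewrite geq_max => /andP[tt tt1] yu.
have [q gq uq] := uP t tt.
have near_q (v : {ffun 'I_n.+1 -> 'I_t.*2.+2}) :
    (forall i, (q i <= v i <= (q i).+1)%N) -> B (pt t v).
  move=> qv; apply: eB; rewrite (splitr e); apply: ball_triangle yu _.
  rewrite uq; split=> [|i j]; first exact: divr_gt0.
  rewrite !ord1 !mxE; rewrite /ball /= ler0_norm; last first.
    by rewrite subr_le0; apply: pos_le; case/andP: (qv j).
  rewrite opprB; have [_ /(pos_le t) vj] := andP (qv j).
  apply: (@le_lt_trans _ _ (pos t (q j).+1 - pos t (q j))); first by rewrite lerD2r.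
  have -> : pos t (q j).+1 - pos t (q j) = 2 * K / (2 * t + 1)%:R.
    by rewrite /pos -addn1 natrD; field; rewrite ?pnatr_eq0 ?addn1.
  rewrite ltr_pdivrMr ?ltr0n ?addn1 // [ltRHS]mulrC -ltr_pdivrMr ?divr_gt0 //.
  apply: lt_le_trans t1e _; rewrite ler_nat; lia.
have [v qv /negbT gv] := gq k false; have [w qw gw] := gq k true.
exists (pt t v), (pt t w); split; [exact: near_q|exact: near_q| |].
  by rewrite subr_le0 leNgt.
by rewrite subr_ge0 ltW.
Qed.

(** * The Euclidean norm *)

Lemma enorm_ge0 (R : realType) d (v : 'rV[R]_d) : 0 <= enorm v.
Proof. exact: sqrtr_ge0. Qed.

Lemma sqr_enorm (R : realType) d (v : 'rV[R]_d) :
  enorm v ^+ 2 = \sum_i v 0 i ^+ 2.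
Proof. by rewrite sqr_sqrtr // sumr_ge0 // => i _; exact: sqr_ge0. Qed.

Lemma enorm0 (R : realType) d : enorm (0 : 'rV[R]_d) = 0.
Proof.
by apply/eqP; rewrite -sqrf_eq0 sqr_enorm big1 // => i _; rewrite mxE expr0n.
Qed.

Lemma ler_abs_enorm (R : realType) d (v : 'rV[R]_d) i : `|v 0 i| <= enorm v.
Proof.
rewrite -sqrtr_sqr ler_wsqrtr // (bigD1 i) //= lerDl.
by rewrite sumr_ge0 // => k _; exact: sqr_ge0.
Qed.

Lemma enorm_eq0 (R : realType) d (v : 'rV[R]_d) : (enorm v == 0) = (v == 0).
Proof.
apply/eqP/eqP => [v0|->]; last exact: enorm0.
apply/rowP => i; rewrite mxE; apply/eqP; rewrite -normr_eq0 eq_le normr_ge0 andbT.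
by rewrite -[leRHS]v0 ler_abs_enorm.
Qed.

(** Cauchy-Schwarz, by expanding the squared norm of [enorm w *: v - enorm v *: w]. *)
Lemma dot_le_enorm (R : realType) d (v w : 'rV[R]_d) :
  \sum_i v 0 i * w 0 i <= enorm v * enorm w.
Proof.
have [/eqP|v0] := eqVneq (enorm v) 0.
  rewrite enorm_eq0 => /eqP ->; rewrite enorm0 mul0r big1 // => i _.
  by rewrite mxE mul0r.
have [/eqP|w0] := eqVneq (enorm w) 0.
  rewrite enorm_eq0 => /eqP ->; rewrite enorm0 mulr0 big1 // => i _.
  by rewrite mxE mulr0.
have vw : 0 < enorm v * enorm w by rewrite mulr_gt0 // lt0r ?v0 ?w0 enorm_ge0.
set s := \sum_i _; have : 0 <= \sum_i (enorm w * v 0 i - enorm v * w 0 i) ^+ 2.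
  by rewrite sumr_ge0 // => i _; exact: sqr_ge0.
have -> : \sum_i (enorm w * v 0 i - enorm v * w 0 i) ^+ 2 =
    enorm w ^+ 2 * (\sum_i v 0 i ^+ 2) + enorm v ^+ 2 * (\sum_i w 0 i ^+ 2) -
    2 * (enorm v * enorm w) * s.
  rewrite !mulr_sumr -sumrN -!big_split /=; apply: eq_bigr => i _; ring.
rewrite -!sqr_enorm; nra.
Qed.

Lemma enorm_triangle (R : realType) d (v w : 'rV[R]_d) :
  enorm (v + w) <= enorm v + enorm w.
Proof.
rewrite -(@ler_pXn2r _ 2) ?nnegrE ?addr_ge0 ?enorm_ge0 //.
rewrite sqrrD !sqr_enorm.
apply: (@le_trans _ _ (\sum_i v 0 i ^+ 2 + (\sum_i v 0 i * w 0 i) *+ 2 +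
  \sum_i w 0 i ^+ 2)); last by rewrite lerD2r lerD2l lerMn2r dot_le_enorm.
rewrite -sumrMnl -!big_split /= ler_sum // => i _.
by rewrite mxE sqrrD.
Qed.

Lemma enormZ (R : realType) d (c : R) (v : 'rV[R]_d) :
  enorm (c *: v) = `|c| * enorm v.
Proof.
rewrite /enorm -sqrtr_sqr -sqrtrM ?sqr_ge0 // mulr_sumr.
by congr Num.sqrt; apply: eq_bigr => i _; rewrite mxE exprMn.
Qed.

Lemma continuous_sumr (R : realType) (T : topologicalType) (I : Type)
    (r : seq I) (F : I -> T -> R) (x : T) :
  (forall i, {for x, continuous (F i)}) ->
  {for x, continuous (fun y => \sum_(i <- r) F i y)}.
Proof.
move=> Fc; apply: (@cvg_big _ _ _ _ _ _ _ (nbhs x)) => [|i _].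
  exact: add_continuous.
exact: Fc.
Qed.

Lemma continuous_enorm (R : realType) (T : topologicalType) d
    (f : T -> 'rV[R]_d) (x : T) :
  (forall i, {for x, continuous (fun y => f y 0 i)}) ->
  {for x, continuous (fun y => enorm (f y))}.
Proof.
move=> fc; apply: (@continuous_comp _ _ _ (fun y => \sum_i f y 0 i ^+ 2)).
  apply: continuous_sumr => i.
  apply: (@continuous_comp _ _ _ (fun y => f y 0 i) (fun x => x ^+ 2)) => //.
  exact: exprn_continuous.
exact: sqrt_continuous.
Qed.

Lemma continuous_row (R : realType) (T : topologicalType) d
    (f : T -> 'rV[R]_d) (x : T) :
  (forall i, {for x, continuous (fun y => f y 0 i)}) -> {for x, continuous f}.
Proof.
move=> fc B [Q hQ QB]; have : \near x, forall i, Q 0 i (f x 0 i).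
  by apply: filter_forall => i; exact: fc (hQ 0 i).
by apply: filterS => y Qy; apply: QB => i j; rewrite ord1.
Qed.

Lemma elipschitz_continuous (R : realType) d (L : R)
    (f : 'rV[R]_d -> 'rV[R]_d) : 0 <= L -> elipschitz L f -> continuous f.
Proof.
move=> L0 fL y; apply: continuous_row => i.
apply/(@cvgrPdist_le _ _ _ (nbhs y)) => e e0.
(* Dividing by [L + 1] covers the case [L = 0]. *)
have L1 : 0 < L + 1 by lra.
have c : {for y, continuous (fun z : 'rV[R]_d => enorm (y - z))}.
  apply: continuous_enorm => k.
  have -> : (fun z : 'rV[R]_d => (y - z) 0 k) = (fun z => y 0 k - z 0 k).
    by apply/funext => z; rewrite !mxE.
  apply: (@continuousB _ _ _ (fun=> y 0 k) (fun z : 'rV[R]_d => z 0 k)).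
    exact: cst_continuous.
  exact: coord_continuous.
have yye : enorm (y - y) < e / (L + 1) by rewrite subrr enorm0 divr_gt0.
have : \forall z \near y, enorm (y - z) < e / (L + 1).
  exact: (cvgr_lt _ c _ yye).
apply: filterS => z; rewrite ltr_pdivlMr // => yz.
have := ler_abs_enorm (f y - f z) i; rewrite !mxE => /le_trans; apply.
apply: le_trans (fL _ _) _; have := enorm_ge0 (y - z); nra.
Qed.

(** For [r > 0], the radial retraction onto the ball of radius [r]; the maximum avoids a case split
    and makes continuity visible. *)
Definition eclip (R : realType) d (r : R) (y : 'rV[R]_d) : 'rV[R]_d :=
  (r / Num.max r (enorm y)) *: y.

Lemma enorm_eclip (R : realType) d (r : R) (y : 'rV[R]_d) :
  0 < r -> enorm (eclip r y) <= r.
Proof.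
move=> r0; rewrite enormZ; have m0 : 0 < Num.max r (enorm y) by rewrite lt_max r0.
rewrite ger0_norm ?divr_ge0 ?(ltW r0) ?(ltW m0) // mulrAC ler_pdivrMr //.
by rewrite ler_pM2l // le_max lexx orbT.
Qed.

Lemma eclip_id (R : realType) d (r : R) (y : 'rV[R]_d) :
  0 < r -> enorm y <= r -> eclip r y = y.
Proof.
by move=> r0 yr; rewrite /eclip max_l // divff ?scale1r // gt_eqF.
Qed.

Lemma eclip_continuous (R : realType) d (r : R) :
  0 < r -> continuous (@eclip R d r).
Proof.
move=> r0 y; apply: continuous_row => i.
have -> : (fun z : 'rV[R]_d => eclip r z 0 i) =
    (fun z => r / Num.max r (enorm z) * z 0 i).
  by apply/funext => z; rewrite mxE.
apply: (@continuousM _ _ (fun z : 'rV[R]_d => r / Num.max r (enorm z))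
  (fun z => z 0 i)); last exact: coord_continuous.
apply: (@continuousM _ _ (fun=> r)); first exact: cst_continuous.
apply: continuousV; first by rewrite gt_eqF // lt_max r0.
apply: (@continuous_max R _ (fun=> r) (@enorm R d)); first exact: cst_continuous.
by apply: continuous_enorm => k; exact: coord_continuous.
Qed.

(** * Interpolation of derivatives *)

(** In characteristic 0, the antiderivative without constant term: at [i = 0] the quotient by 0 is
    0. *)
Definition primitive_poly (R : fieldType) (p : {poly R}) : {poly R} :=
  \poly_(i < (size p).+1) (p`_i.-1 / i%:R).

Lemma deriv_primitive_poly (R : numFieldType) (p : {poly R}) :
  (primitive_poly p)^`() = p.
Proof.
apply/polyP => i; rewrite coef_deriv coef_poly ltnS /=.
case: ltnP => [_|pi]; last by rewrite mul0rn nth_default.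
by rewrite -[LHS]mulr_natr divfK // pnatr_eq0.
Qed.

Lemma poly_eq0_nodes (R : idomainType) (P : {fset R}) (p : {poly R}) :
  (size p <= #|` P|)%N -> (forall eta, eta \in P -> p.[eta] = 0) -> p = 0.
Proof.
move=> sp rp; apply/eqP; apply: contraLR sp => p0; rewrite -ltnNge.
apply: max_poly_roots p0 _ (fset_uniq P).
by apply/allP => eta /rp e; rewrite /root e.
Qed.

Lemma lagrange_interp (R : realType) (P : {fset R}) (p : {poly R}) :
  (size p <= #|` P|)%N ->
  p = \sum_(eta <- P) p.[eta] *: lagrange_basis P eta.
Proof.
move=> sp; apply/eqP; rewrite -subr_eq0; apply/eqP.
apply: (@poly_eq0_nodes _ P) => [|gamma gP].
  apply: leq_trans (size_polyD _ _) _; rewrite geq_max sp size_polyN.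
  rewrite big_seq; apply: leq_trans (size_sum _ _ _) _.
  apply/bigmax_leqP_seq => eta _ eP.
  by apply: leq_trans (size_scale_leq _ _) _; rewrite size_lagrange_basis.
rewrite hornerD hornerN horner_sum (big_rem gamma) //=.
rewrite hornerZ lagrange_basis_sample // eqxx mulr1 big_seq big1 ?addr0 ?subrr //.
move=> eta; rewrite mem_rem_uniq ?fset_uniq // => /andP[/= ne _].
by rewrite hornerZ lagrange_basis_sample // eq_sym (negbTE ne) mulr0.
Qed.

Lemma size_deriv_le (R : nzSemiRingType) (p : {poly R}) n :
  (size p <= n.+1)%N -> (size p^`() <= n)%N.
Proof.
have [->|p0] := eqVneq p 0; first by rewrite deriv0 size_poly0.
by move=> sp; rewrite -ltnS; exact: leq_trans (lt_size_deriv p0) sp.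
Qed.

Lemma poly_increment_le (R : realType) (P : {fset R}) (a b s t m : R)
    (p : {poly R}) :
  a <= b -> s \in `[a, b] -> t \in `[a, b] -> 0 <= m ->
  (size p <= #|` P|.+1)%N ->
  (forall eta, eta \in P -> `|p^`().[eta]| <= m) ->
  `|p.[t] - p.[s]| <= (b - a) * lebesgue_constant P a b * m.
Proof.
move=> ab; wlog st : s t / s <= t => [H sI tI m0 sp pm|].
  by have [/H|/ltW/H] := leP s t; [|rewrite distrC]; apply.
move=> sI tI m0 sp pm.
have [c cI ->] : exists2 c, c \in `[s, t] & p.[t] - p.[s] = p^`().[c] * (t - s).
  apply: (@MVT_segment R (horner p) (horner p^`())) => //.
  by apply: continuous_subspaceT => x; exact: continuous_horner.
have {}cI : c \in `[a, b].
  move: sI tI cI; rewrite !in_itv /= => /andP[? _] /andP[_ ?] /andP[? ?].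
  by apply/andP; split; lra.
have [_ /(_ c cI) leL] := lebesgue_constant_max P ab.
have pc : `|p^`().[c]| <= lebesgue_constant P a b * m.
  rewrite (lagrange_interp (size_deriv_le sp)) horner_sum.
  apply: le_trans (ler_norm_sum _ _ _) _.
  apply: le_trans (ler_wpM2r m0 leL); rewrite mulr_suml.
  rewrite big_seq [leRHS]big_seq; apply: ler_sum => eta eP.
  by rewrite hornerZ normrM mulrC ler_wpM2l // pm.
have ts : 0 <= t - s <= b - a.
  by move: sI tI; rewrite !in_itv /= => /andP[? ?] /andP[? ?]; apply/andP; lra.
have [ts0 tsb] := andP ts.
rewrite normrM (ger0_norm ts0) mulrC -mulrA ler_pM //.
Qed.

(* Testing against the vector [v := X(t) - X(s)] reduces the Euclidean bound to
   the scalar polynomial [\sum_i v_i X_i]. *)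
Lemma vhorner_increment_le (R : realType) d n (P : {fset R}) (a b s t m : R)
    (X : 'rV[{poly R}]_d) :
  #|` P| = n -> a <= b -> s \in `[a, b] -> t \in `[a, b] -> 0 <= m ->
  vdeg_le n X ->
  (forall eta, eta \in P -> enorm (vhorner (vderiv X) eta) <= m) ->
  enorm (vhorner X t - vhorner X s) <= (b - a) * lebesgue_constant P a b * m.
Proof.
move=> cP ab sI tI m0 dX Xm; set v := _ - _.
pose p := \sum_i v 0 i *: X 0 i.
have [->|v0] := eqVneq v 0.
  (* The scalar estimate for the zero polynomial shows that the bound is nonnegative. *)
  rewrite enorm0; apply: le_trans (@poly_increment_le _ P a b s t m 0 ab sI tI m0 _ _).
  - exact: normr_ge0.
  - by rewrite size_poly0.
  - by move=> eta _; rewrite deriv0 horner0 normr0.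
have v_gt0 : 0 < enorm v by rewrite lt0r enorm_eq0 v0 enorm_ge0.
rewrite -(ler_pM2l v_gt0) -expr2.
have -> : enorm v ^+ 2 = p.[t] - p.[s].
  rewrite sqr_enorm /p !horner_sum -sumrB; apply: eq_bigr => i _.
  by rewrite !hornerZ -mulrBr expr2; congr (_ * _); rewrite !mxE.
apply: le_trans (ler_norm _) _; rewrite mulrCA.
apply: (@poly_increment_le _ P) => //; first by rewrite mulr_ge0 // ltW.
  rewrite cP; apply: leq_trans (size_sum _ _ _) _; apply/bigmax_leqP => i _.
  exact: leq_trans (size_scale_leq _ _) (dX i).
move=> eta eP.
have -> : p^`().[eta] = \sum_i v 0 i * vhorner (vderiv X) eta 0 i.
  rewrite /p raddf_sum horner_sum; apply: eq_bigr => i _.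
  by rewrite /= derivZ hornerZ !mxE.
(* Used for [v] and [- v], this bounds the absolute value. *)
have le_m (w : 'rV[R]_d) :
    enorm w = enorm v -> \sum_i w 0 i * vhorner (vderiv X) eta 0 i <= enorm v * m.
  move=> wv; apply: le_trans (dot_le_enorm _ _) _.
  by rewrite wv ler_pM2l // Xm.
rewrite ler_norml le_m // andbT lerNl -sumrN.
apply: le_trans (le_m (- v) _); last by rewrite -scaleN1r enormZ normrN1 mul1r.
by apply: ler_sum => i _; rewrite !mxE mulNr.
Qed.

(* The polynomial with value [x] at [mu] whose derivative takes the value
   [y 0 (mxvec_index k i)] at the [k]-th node, in coordinate [i]. *)
Definition interp_candidate (R : realType) d n (P : {fset R}) (mu : R)
    (x : 'rV[R]_d) (y : 'rV[R]_(n * d)) : 'rV[{poly R}]_d :=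
  \row_i ((x 0 i)%:P + \sum_(k < n) y 0 (mxvec_index k i) *:
     (primitive_poly (lagrange_basis P P`_k) -
      (primitive_poly (lagrange_basis P P`_k)).[mu]%:P)).

Lemma vdeg_le_candidate (R : realType) d n (P : {fset R}) (mu : R)
    (x : 'rV[R]_d) (y : 'rV[R]_(n * d)) :
  #|` P| = n -> vdeg_le n (interp_candidate P mu x y).
Proof.
move=> cP i; rewrite mxE; apply: leq_trans (size_polyD _ _) _.
rewrite geq_max (leq_trans (size_polyC_leq1 _)) //=.
apply: leq_trans (size_sum _ _ _) _; apply/bigmax_leqP => k _.
apply: leq_trans (size_scale_leq _ _) _; apply: leq_trans (size_polyD _ _) _.
rewrite size_polyN geq_max (leq_trans (size_polyC_leq1 _)) // andbT.
apply: leq_trans (size_poly _ _) _.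
by rewrite size_lagrange_basis ?cP // mem_nth // cP.
Qed.

Lemma vhorner_candidate_mu (R : realType) d n (P : {fset R}) (mu : R)
    (x : 'rV[R]_d) (y : 'rV[R]_(n * d)) :
  vhorner (interp_candidate P mu x y) mu = x.
Proof.
apply/rowP => i; rewrite !mxE hornerD hornerC horner_sum big1 ?addr0 // => k _.
by rewrite hornerZ hornerD hornerN hornerC subrr mulr0.
Qed.

Lemma vderiv_candidate (R : realType) d n (P : {fset R}) (mu : R)
    (x : 'rV[R]_d) (y : 'rV[R]_(n * d)) (k : 'I_n) :
  #|` P| = n ->
  vhorner (vderiv (interp_candidate P mu x y)) P`_k =
  \row_i y 0 (mxvec_index k i).
Proof.
move=> cP; apply/rowP => i; rewrite !mxE derivD derivC add0r raddf_sum horner_sum.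
have kP : P`_k \in P by rewrite mem_nth // cP.
rewrite (bigD1 k) //= big1 => [|j jk]; rewrite /= derivZ derivB derivC subr0;
  rewrite deriv_primitive_poly hornerZ lagrange_basis_sample //.
  by rewrite eqxx mulr1 addr0.
by rewrite nth_uniq ?fset_uniq ?cP // eq_sym val_eqE (negbTE jk) mulr0.
Qed.

(** * Existence for bounded continuous maps *)

Lemma interp_solution_bounded (R : realType) (d n : nat) (P : {fset R})
    (mu : R) (x : 'rV[R]_d) (Phi : 'rV[R]_d -> R -> 'rV[R]_d) :
  #|` P| = n ->
  (forall eta, eta \in P ->
     ebounded (fun y => Phi y eta) /\ continuous (fun y => Phi y eta)) ->
  exists X : 'rV[{poly R}]_d, interp_solution n P Phi mu x X.
Proof.
move=> cP hPhi; pose X (y : 'rV[R]_(n * d)) := interp_candidate P mu x y.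
have /choice[M PhiM] : forall eta, exists M, eta \in P ->
    forall y, enorm (Phi y eta) <= M.
  move=> eta; have [/hPhi[[M HM] _]|_] := boolP (eta \in P); last by exists 0.
  by exists M => _; exact: HM.
(* A fixed point of [g] is a family of nodal derivatives whose candidate satisfies the equation at
   every node. *)
pose g (k : 'I_(n * d)) (y : 'rV[R]_(n * d)) :=
  mxvec (\matrix_(j, i) Phi (vhorner (X y) P`_j) P`_j 0 i) 0 k.
have inP (j : 'I_n) : P`_j \in P by rewrite mem_nth // cP.
have gE j i y : g (mxvec_index j i) y = Phi (vhorner (X y) P`_j) P`_j 0 i.
  by rewrite /g mxvecE mxE.
have [|k y|y gy] := @bounded_fixpoint R (n * d) g (\sum_(eta <- P) `|M eta|).
- case/mxvec_indexP => j i; rewrite (funext (gE j i)) => y.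
  apply: (@continuous_comp _ _ _ (fun y => vhorner (X y) P`_j)
    (fun z => Phi z P`_j 0 i)); last first.
    apply: (@continuous_comp _ _ _ (fun z => Phi z P`_j)
      (fun z : 'rV[R]_d => z 0 i)); last exact: coord_continuous.
    exact: (hPhi _ (inP j)).2.
  apply: continuous_row => l.
  have -> : (fun y => vhorner (X y) P`_j 0 l) = (fun y : 'rV[R]_(n * d) => x 0 l +
      \sum_(k < n) y 0 (mxvec_index k l) *
       (primitive_poly (lagrange_basis P P`_k) -
        (primitive_poly (lagrange_basis P P`_k)).[mu]%:P).[P`_j]).
    apply/funext => z; rewrite !mxE hornerD hornerC horner_sum.
    by congr (_ + _); apply: eq_bigr => k _; rewrite hornerZ.
  apply: (@continuousD _ _ _ (fun=> x 0 l)); first exact: cst_continuous.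
  apply: continuous_sumr => k.
  apply: (@continuousM _ _ (fun y : 'rV[R]_(n * d) => y 0 (mxvec_index k l))).
    exact: coord_continuous.
  exact: cst_continuous.
- case/mxvec_indexP: k => j i; rewrite gE.
  apply: le_trans (ler_abs_enorm _ _) _.
  apply: le_trans (PhiM _ (inP j) _) _; apply: le_trans (ler_norm _) _.
  by rewrite (big_rem _ (inP j)) /= lerDl sumr_ge0.
exists (X y); split; [exact: vdeg_le_candidate| |exact: vhorner_candidate_mu].
move=> eta eP; have jn : (index eta P < n)%N by rewrite -cP index_mem.
have <- : P`_(Ordinal jn) = eta by rewrite /= nth_index.
by rewrite vderiv_candidate //; apply/rowP => i; rewrite mxE -gy gE.
Qed.

(** * Uniqueness and existence for Lipschitz maps *)

Lemma vhornerB (R : realType) d (X Y : 'rV[{poly R}]_d) t :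
  vhorner (X - Y) t = vhorner X t - vhorner Y t.
Proof. by apply/rowP => i; rewrite !mxE hornerD hornerN. Qed.

Lemma vderivB (R : realType) d (X Y : 'rV[{poly R}]_d) :
  vderiv (X - Y) = vderiv X - vderiv Y.
Proof. by apply/rowP => i; rewrite !mxE derivB. Qed.

Lemma vdeg_leB (R : realType) d n (X Y : 'rV[{poly R}]_d) :
  vdeg_le n X -> vdeg_le n Y -> vdeg_le n (X - Y).
Proof.
move=> dX dY i; rewrite !mxE; apply: leq_trans (size_polyD _ _) _.
by rewrite size_polyN geq_max dX dY.
Qed.

Lemma lebesgue_constant_ge0 (R : realType) (P : {fset R}) (a b : R) :
  a <= b -> 0 <= lebesgue_constant P a b.
Proof.
move=> ab; have [[xi _ ->] _] := lebesgue_constant_max P ab.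
by apply: sumr_ge0 => eta _; exact: normr_ge0.
Qed.

(** The derivative has degree below [n] and [n] zeros, so [X] is constant, with value 0 at [mu]. *)
Lemma vderiv_nodes_eq0 (R : realType) d n (P : {fset R}) (mu : R)
    (X : 'rV[{poly R}]_d) :
  #|` P| = n -> vdeg_le n X -> vhorner X mu = 0 ->
  (forall eta, eta \in P -> vhorner (vderiv X) eta = 0) -> X = 0.
Proof.
move=> cP dX X0 dX0; apply/rowP => i; rewrite mxE.
have dXi : (X 0 i)^`() = 0.
  apply: (@poly_eq0_nodes _ P) => [|eta eP]; first by rewrite cP size_deriv_le.
  by have /rowP/(_ i) := dX0 _ eP; rewrite !mxE.
have sXi : (size (X 0%R i) <= 1)%N.
  apply/leq_sizeP => -[//|k] _; apply/eqP.
  have /eqP := congr1 (fun p : {poly R} => p`_k) dXi.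
  by rewrite coef_deriv coef0 mulrn_eq0.
have /rowP/(_ i) := X0; rewrite !mxE (size1_polyC sXi) hornerC => ->.
by rewrite polyC0.
Qed.

(** Let [m] be the largest nodal distance of the solutions. Their nodal derivatives differ by at
    most [L * m], and integrating from [mu] bounds [m] by a factor below 1 times [m], so [m = 0]. *)
Lemma interp_solution_unique (R : realType) (d n : nat) (P : {fset R})
    (mu : R) (x : 'rV[R]_d) (a b : R) (Phi : 'rV[R]_d -> R -> 'rV[R]_d) (L : R)
    (X Y : 'rV[{poly R}]_d) :
  #|` P| = n -> a <= b -> (forall eta, eta \in P -> eta \in `[a, b]) ->
  mu \in `[a, b] -> 0 <= L ->
  (forall eta, eta \in P -> elipschitz L (fun y => Phi y eta)) ->
  lebesgue_constant P a b * L * (b - a) < 1 ->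
  interp_solution n P Phi mu x X -> interp_solution n P Phi mu x Y -> X = Y.
Proof.
move=> cP ab PI muI L0 PhiL q1 [dX eX muX] [dY eY muY].
pose D := X - Y.
pose m := \big[Num.max/0]_(eta <- P) enorm (vhorner D eta).
have m0 : 0 <= m by exact: bigmax_ge_id.
have em eta : eta \in P -> enorm (vhorner D eta) <= m.
  by move=> eP; exact: (le_bigmax_seq 0 eta xpredT (fun eta => enorm (vhorner D eta)) eP).
have dD : vdeg_le n D by exact: vdeg_leB.
have muD : vhorner D mu = 0 by rewrite vhornerB muX muY subrr.
have derD eta : eta \in P -> enorm (vhorner (vderiv D) eta) <= L * m.
  move=> eP; rewrite vderivB vhornerB eX // eY //.
  apply: le_trans (PhiL _ eP _ _) _; rewrite ler_wpM2l // -vhornerB; exact: em.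
have mq : m <= lebesgue_constant P a b * L * (b - a) * m.
  rewrite {1}/m big_seq; apply: bigmax_le => [|eta eP].
    by rewrite !mulr_ge0 ?lebesgue_constant_ge0 // subr_ge0.
  have := vhorner_increment_le cP ab muI (PI _ eP) (mulr_ge0 L0 m0) dD derD.
  by rewrite muD subr0; congr (_ <= _); ring.
have {mq}m_eq0 : m = 0 by apply: le_anti; rewrite m0 andbT; nra.
apply/eqP; rewrite -subr_eq0; apply/eqP.
apply: (@vderiv_nodes_eq0 _ _ _ _ mu _ cP dD muD) => eta /derD.
rewrite m_eq0 mulr0 => e; apply/eqP.
by rewrite -enorm_eq0 eq_le e enorm_ge0.
Qed.

(* Truncating every [Phi(., eta)] to the ball of radius [r] makes it bounded;
   the contraction hypothesis keeps the solution of the truncated problem inside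
   this ball, where nothing was changed. *)
Lemma interp_solution_lipschitz (R : realType) (d n : nat) (P : {fset R})
    (mu : R) (x : 'rV[R]_d) (a b : R) (Phi : 'rV[R]_d -> R -> 'rV[R]_d) (L : R) :
  #|` P| = n -> a <= b -> (forall eta, eta \in P -> eta \in `[a, b]) ->
  mu \in `[a, b] -> 0 <= L ->
  (forall eta, eta \in P -> elipschitz L (fun y => Phi y eta)) ->
  lebesgue_constant P a b * L * (b - a) < 1 ->
  exists X : 'rV[{poly R}]_d, interp_solution n P Phi mu x X.
Proof.
move=> cP ab PI muI L0 PhiL q1.
set q := lebesgue_constant P a b * L * (b - a) in q1.
pose C := \big[Num.max/0]_(eta <- P) enorm (Phi 0 eta).
have C0 : 0 <= C by exact: bigmax_ge_id.
have PhiC eta : eta \in P -> enorm (Phi 0 eta) <= C.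
  by move=> eP; exact: (le_bigmax_seq 0 eta xpredT (fun eta => enorm (Phi 0 eta)) eP).
pose A := (b - a) * lebesgue_constant P a b.
have A0 : 0 <= A by rewrite mulr_ge0 ?lebesgue_constant_ge0 ?subr_ge0.
(* The truncated solution is bounded at the nodes by [enorm x + A * (C + L * r)], where [A * L = q];
   this [r] exceeds that bound by 1. *)
pose r := (enorm x + A * C + 1) / (1 - q).
have q0 : 0 < 1 - q by rewrite subr_gt0.
have r0 : 0 < r.
  by apply: divr_gt0 q0; have := enorm_ge0 x; have := mulr_ge0 A0 C0; lra.
have rE : r = enorm x + A * C + 1 + q * r.
  by rewrite /r; field; rewrite gt_eqF.
have clipL eta y : eta \in P -> enorm (Phi (eclip r y) eta) <= C + L * r.
  move=> eP; rewrite -[Phi (eclip r y) eta](subrK (Phi 0 eta)).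
  apply: le_trans (enorm_triangle _ _) _; rewrite addrC lerD ?PhiC //.
  apply: le_trans (PhiL _ eP _ _) _; rewrite subr0.
  by rewrite ler_wpM2l // enorm_eclip.
have [eta eP|X [dX eX muX]] := @interp_solution_bounded R d n P mu x
  (fun y => Phi (eclip r y)) cP.
  split; first by exists (C + L * r) => y; exact: clipL.
  move=> y; apply: (@continuous_comp _ _ _ (eclip r) (fun z => Phi z eta)).
    exact: eclip_continuous.
  exact: elipschitz_continuous (PhiL _ eP) _.
exists X; split=> // eta eP; rewrite eX // eclip_id //.
have Xm gamma : gamma \in P -> enorm (vhorner (vderiv X) gamma) <= C + L * r.
  by move=> gP; rewrite eX // clipL.
have m0 : 0 <= C + L * r by rewrite addr_ge0 // mulr_ge0 // ltW.
have := vhorner_increment_le cP ab muI (PI _ eP) m0 dX Xm; rewrite muX -/A => h.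
rewrite -(subrK x (vhorner X eta)); apply: le_trans (enorm_triangle _ _) _.
rewrite rE; have -> : q * r = A * (L * r) by rewrite /q /A; ring.
by move: h; rewrite mulrDr; lra.
Qed.

Theorem proposition4p1 (R : realType) (d n : nat) (hd : (1 <= d)%N)
    (hn : (1 <= n)%N) (P : {fset R}) (hP : #|` P| = n)
    (mu : R) (x : 'rV[R]_d) (a b : R) (hab : a <= b)
    (hPI : forall eta, eta \in P -> eta \in `[a, b])
    (hmuI : mu \in `[a, b])
    (Phi : 'rV[R]_d -> R -> 'rV[R]_d) :
  ((forall eta, eta \in P ->
      ebounded (fun y => Phi y eta) /\ continuous (fun y => Phi y eta)) ->
   exists X : 'rV[{poly R}]_d, interp_solution n P Phi mu x X)
  /\
  (forall L : R,
     (forall eta, eta \in P -> elipschitz L (fun y => Phi y eta)) ->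
     lebesgue_constant P a b * L * (b - a) < 1 ->
   exists! X : 'rV[{poly R}]_d, interp_solution n P Phi mu x X).
Proof.
split; first exact: interp_solution_bounded.
(* A negative [L] is replaced by 0, for which the contraction condition reads [0 < 1]. *)
move=> L hL hq; pose L' := Num.max L 0.
have L'0 : 0 <= L' by rewrite le_max lexx orbT.
have hL' eta : eta \in P -> elipschitz L' (fun y => Phi y eta).
  move=> eP y z; apply: le_trans (hL _ eP y z) _.
  by rewrite ler_wpM2r ?enorm_ge0 // le_max lexx.
have hq' : lebesgue_constant P a b * L' * (b - a) < 1.
  by rewrite /L'; case: (leP L 0) => // _; rewrite mulr0 mul0r ltr01.
have [X hX] := interp_solution_lipschitz x hP hab hPI hmuI L'0 hL' hq'.
exists X; split=> // Y hY.
exact: interp_solution_unique hP hab hPI hmuI L'0 hL' hq' hX hY.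
Qed.
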